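(* Let $Y$ be a topological vector space, let $A$ be a closed proper subset of $Y$, and let $k\in Y\setminus\{0\}$ be such that $A-\mathbb{R}_{>}k\subseteq\operatorname{int}A$. Put $A':=Y\setminus\operatorname{int}A$. Then $A'$ is a closed proper subset of $Y$ with $A'-\mathbb{R}_{>}(-k)\subseteq\operatorname{int}A'$, and: (a) $\operatorname{bd}A+\mathbb{R}k$ is the subset of $Y$ on which $\varphi_{A,k}$ is finite-valued as well as the subset of $Y$ on which $\varphi_{A',-k}$ is finite-valued. (b) $\operatorname{dom}\varphi_{A,k}\cap\operatorname{dom}\varphi_{A',-k}=\operatorname{bd}A+\mathbb{R}k$. (c) $\varphi_{A,k}(y)=-\varphi_{A',-k}(y)$ for all $y\in\operatorname{bd}A+\mathbb{R}k$.
   Context: Vector spaces are real; $\mathbb{R}_{>}=\{t\in\mathbb{R}\mid t>0\}$. ''Proper subset of $Y$'' means nonempty and different from $Y$. $\operatorname{int},\operatorname{bd}$ are topological interior and boundary. $\nu$ is a symbolic value not in $\overline{\mathbb{R}}=\mathbb{R}\cup\{\pm\infty\}$, and $\inf\emptyset:=\nu$. For $M\subseteq Y$ and $h\in Y\setminus\{0\}$, $\varphi_{M,h}:Y\to\overline{\mathbb{R}}\cup\{\nu\}$ is $\varphi_{M,h}(y)=\inf\{t\in\mathbb{R}\mid y\in th+M\}$; $\operatorname{dom}\varphi_{M,h}=\{y\in Y\mid\varphi_{M,h}(y)\in\mathbb{R}\cup\{-\infty\}\}$. ''The subset on which $\varphi$ is finite-valued'' is $\{y\in Y\mid\varphi(y)\in\mathbb{R}\}$.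 *)

(* Defs.v *)
From HB Require Import structures.
From mathcomp Require Import all_boot all_order all_algebra.
From mathcomp Require Import all_classical all_reals all_analysis.

Set Implicit Arguments.
Unset Strict Implicit.
Unset Printing Implicit Defensive.

Import Order.TTheory GRing.Theory Num.Theory.
Import numFieldNormedType.Exports.

Local Open Scope classical_set_scope.
Local Open Scope ring_scope.

Definition proper_subset (T : Type) (A : set T) : Prop :=
  A !=set0 /\ A <> setT.

Definition boundary (T : topologicalType) (A : set T) : set T :=
  closure A `\` A°.

Definition set_add (V : zmodType) (A B : set V) : set V :=
  [set a + b | a in A & b in B].

Definition set_sub (V : zmodType) (A B : set V) : set V :=
  [set a - b | a in A & b in B].

Definition line (R : numDomainType) (V : lmodType R) (h : V) : set V :=
  [set t *: h | t in [set: R]].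

Definition open_ray (R : numDomainType) (V : lmodType R) (h : V) : set V :=
  [set t *: h | t in [set t : R | 0 < t]].

(* The extended reals with the symbolic value nu adjoined: [None] is nu. *)
Definition nu_ereal (R : numDomainType) : Type := option (\bar R).

(* The convention inf set0 = nu replaces [ereal_inf set0 = +oo]. *)
Definition nu_inf (R : realType) (S : set R) : nu_ereal R :=
  if S == set0 then None else Some (ereal_inf (EFin @` S)).

Definition nu_opp (R : numDomainType) (v : nu_ereal R) : nu_ereal R :=
  omap oppe v.

Definition phi (R : realType) (Y : lmodType R) (M : set Y) (h : Y) (y : Y) :
    nu_ereal R :=
  nu_inf [set t : R | set_add [set t *: h] M y].

Definition nu_dom (R : realType) (Y : Type) (f : Y -> nu_ereal R) : set Y :=
  [set y | (exists r : R, f y = Some r%:E) \/ f y = Some -oo%E].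

Definition finite_valued (R : realType) (Y : Type) (f : Y -> nu_ereal R) :
    set Y :=
  [set y | exists r : R, f y = Some r%:E].

(* Main.v *)
Require Import Defs.
From HB Require Import structures.
From mathcomp Require Import all_boot all_order all_algebra.
From mathcomp Require Import all_classical all_reals all_analysis.

Import Order.TTheory GRing.Theory Num.Theory.
Import numFieldNormedType.Exports.

Local Open Scope classical_set_scope.
Local Open Scope ring_scope.

(** Fix a point [y] and walk along the line [t |-> y - t *: k].  The hypothesis
    on [A] says that as soon as this walk is in [A] it is in the interior of
    [A] at all later times, and the times spent in [A] form a closed set.  So
    the walk is either always in the interior of [A] (value [-oo]), never in
    [A] (value nu), or it meets [bd A] at exactly one time [r], being outside
    [A] before [r] and in the interior after it.  Hence [phi A k y = r] if and
    only if [y - r *: k] lies in [bd A] ([phi_finiteE]).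

    The set [A'] satisfies the same hypothesis for the direction [- k], because
    a backward walk that starts outside the interior of [A] can never be in
    [A].  Moreover [A] is the closure of its interior, so [A] and [A'] have the
    same boundary ([boundary_setC_interior]).  The characterization of finite
    values therefore applies to both functionals with the same boundary:
    [phi A k y = r] and [phi A' (- k) y = - r] are both equivalent to
    [y - r *: k \in bd A].  This gives (a) and (c).  For (b) it remains to see
    that both values cannot be [-oo]: in that case the whole walk is in the
    interior of [A], so it never meets [A']. *)

Section DirectionallyAbsorbing.
Variables (R : realType) (Y : topologicalLmodType R).
Implicit Types (M : set Y) (h x y : Y) (t r : R).

(** All the topological vector space structure is used through this fact: the
    affine map [t |-> x - t *: h] is continuous at [0]. *)
Lemma nbhs_line M x h : nbhs x M ->
  exists2 d : R, 0 < d & forall t, `|t| < d -> M (x - t *: h).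
Proof.
move=> Mx.
have fx : (fun t : R^o => x - t *: h) @ (0 : R^o) --> x.
  rewrite -[X in _ --> X]subr0 -[X in _ --> x - X](scale0r h).
  apply: (cvg_comp2 (cvg_cst _) _ (add_continuous (_, _))).
  apply: continuous_cvg; first exact: opp_continuous.
  exact: (cvg_comp2 cvg_id (cvg_cst _) (scale_continuous (_, _))).
have /= [d d0 dM] := fx M Mx.
by exists d => // t td; apply: dM => /=; rewrite sub0r normrN.
Qed.

Lemma set_sub_rayP M h (B : set Y) :
  set_sub M (open_ray h) `<=` B <->
  forall x t, M x -> 0 < t -> B (x - t *: h).
Proof.
split=> [MB x t Mx t0|MB _ [x Mx [_ [t /= t0 <-] <-]]]; last exact: MB.
by apply: MB; exists x => //; exists (t *: h) => //; exists t.
Qed.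

Lemma set_add_singletonE M x y : set_add [set x] M y <-> M (y - x).
Proof.
split=> [[_ -> [m Mm <-]]|Myx]; first by rewrite [x + m]addrC addrK.
by exists x => //; exists (y - x) => //; rewrite addrC subrK.
Qed.

Lemma set_add_lineP M h y :
  set_add M (line h) y <-> exists r, M (y - r *: h).
Proof.
split=> [[m Mm [_ [r _ <-] <-]]|[r Mr]]; first by exists r; rewrite addrK.
by exists (y - r *: h) => //; exists (r *: h); [exists r|rewrite subrK].
Qed.

Lemma phiE M h y :
  phi M h y = nu_inf [set t | M (y - t *: h)].
Proof.
by congr nu_inf; apply/seteqP; split=> t /= /set_add_singletonE.
Qed.

Lemma phi_SomeP M h y v : phi M h y = Some v <->
  (exists t, M (y - t *: h)) /\
  ereal_inf (EFin @` [set t | M (y - t *: h)]) = v.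
Proof.
rewrite phiE /nu_inf; case: eqP => [S0|/eqP/set0P S0]; split=> //.
- by move=> [[t Mt]]; have : [set t | M (y - t *: h)] t by []; rewrite S0.
- by move=> [<-].
- by move=> [_ ->].
Qed.

(** This is the form in which the hypothesis on [M] enters every argument about
    [phi]: two points of the walk from [y] differ by a multiple of [h]. *)
Lemma absorbing_later M h y t s :
  set_sub M (open_ray h) `<=` M° ->
  M (y - t *: h) -> t < s -> M° (y - s *: h).
Proof.
move=> /set_sub_rayP MM My ts.
have -> : y - s *: h = y - t *: h - (s - t) *: h.
  by rewrite scalerBl opprB addrA subrK.
by apply: MM => //; rewrite subr_gt0.
Qed.

(** An infimum [-oo] means that the walk is in [M] at arbitrarily early times,
    hence in the interior of [M] at every time. *)
Lemma phi_ninfty_interior M h y :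
  set_sub M (open_ray h) `<=` M° ->
  phi M h y = Some -oo%E -> forall t, M° (y - t *: h).
Proof.
move=> MM /phi_SomeP[_ Soo] t.
have [_ [s /= Ms <-]] := lb_ereal_infNy_adherent t Soo.
by rewrite lte_fin; exact: absorbing_later.
Qed.

(** If [r] is the infimum of the times spent in [M], then [y - r *: h] cannot
    be outside the closed set [M], as the walk would stay outside for some
    time after [r]; nor can it be interior, as the walk would have been in [M]
    shortly before [r].  Conversely, a boundary point can only be met on
    entering [M], since all later points are interior. *)
Lemma phi_finiteE M h y r :
  closed M -> set_sub M (open_ray h) `<=` M° ->
  phi M h y = Some r%:E <-> boundary M (y - r *: h).
Proof.
move=> Mcl MM; split=> [/phi_SomeP[_ Sr]|[/Mcl Mr NMr]].
- have line_near (B : set Y) : nbhs (y - r *: h) B ->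
      exists2 d : R, 0 < d & forall t, `|t - r| < d -> B (y - t *: h).
    move=> /(@nbhs_line _ _ h)[d d0 dB]; exists d => // t /dB.
    by rewrite scalerBl opprB addrA subrK.
  have rlb t : M (y - t *: h) -> r <= t.
    by move=> Mt; rewrite -lee_fin -Sr; apply: ereal_inf_lbound; exists t.
  split.
  + apply: subset_closure; apply: contrapT => NMr.
    have /line_near[d d0 dN] : nbhs (y - r *: h) (~` M).
      by apply: open_nbhs_nbhs; split=> //; exact: closed_openC.
    have : (ereal_inf (EFin @` [set t | M (y - t *: h)%R]) < (r + d)%:E)%E.
      by rewrite Sr lte_fin ltrDl.
    move=> /ereal_inf_lt[_ [t /= Mt <-]]; rewrite lte_fin => td.
    by apply: dN (Mt); rewrite ger0_norm ?subr_ge0 ?rlb// ltrBlDl.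
  + move=> /line_near[d d0 dM].
    have /rlb : M (y - (r - d / 2) *: h).
      apply: dM; rewrite addrAC subrr sub0r normrN gtr0_norm ?divr_gt0//.
      by rewrite ltr_pdivrMr// ltr_pMr// ltr1n.
    by apply/negP; rewrite -ltNge ltrBlDr ltrDl divr_gt0.
- apply/phi_SomeP; split; first by exists r.
  apply/eqP; rewrite eq_le; apply/andP; split.
    by apply: ereal_inf_lbound; exists r.
  apply: le_ereal_inf_tmp => _ [t /= Mt <-]; rewrite lee_fin leNgt.
  by apply/negP => tr; apply: NMr; exact: absorbing_later Mt tr.
Qed.

Lemma finite_valued_phi M h :
  closed M -> set_sub M (open_ray h) `<=` M° ->
  finite_valued (phi M h) = set_add (boundary M) (line h).
Proof.
move=> Mcl MM; apply/seteqP; split=> y.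
  by move=> [r /(phi_finiteE _ _ _ _ Mcl MM) ?]; apply/set_add_lineP; exists r.
move=> /set_add_lineP[r ?]; exists r; exact/phi_finiteE.
Qed.

Lemma lineN h : line (- h) = line h.
Proof.
by apply/seteqP; split=> _ [t _ <-]; exists (- t) => //;
  rewrite scaleNr ?scalerN ?opprK.
Qed.

(** A point of [M] is the limit of the interior points [x - t *: h] as [t]
    decreases to [0]. *)
Lemma closure_interior_absorbing M h :
  closed M -> set_sub M (open_ray h) `<=` M° -> closure M° = M.
Proof.
move=> Mcl /set_sub_rayP MM; apply/seteqP; split.
  by move=> x /(closureS (@interior_subset _ M))/Mcl.
move=> x Mx B /(@nbhs_line _ _ h)[d d0 dB].
have d20 : 0 < d / 2 by rewrite divr_gt0.
exists (x - (d / 2) *: h); split; first exact: MM.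
by apply: dB; rewrite gtr0_norm// ltr_pdivrMr// ltr_pMr// ltr1n.
Qed.

(** Taking the complement of the interior is therefore an involution on the
    sets considered here, so that [M] and [~` M°] play symmetric roles. *)
Lemma interior_setC_interior M h :
  closed M -> set_sub M (open_ray h) `<=` M° -> (~` M°)° = ~` M.
Proof.
by move=> Mcl MM; rewrite interiorC (closure_interior_absorbing _ _ Mcl MM).
Qed.

Lemma closed_setC_interior M : closed (~` M°).
Proof. exact/open_closedC/open_interior. Qed.

Lemma boundary_setC_interior M h :
  closed M -> set_sub M (open_ray h) `<=` M° ->
  boundary (~` M°) = boundary M.
Proof.
move=> Mcl MM; rewrite /boundary (interior_setC_interior _ _ Mcl MM).
rewrite -(closure_id _).1; last exact: closed_setC_interior.
by rewrite -(closure_id _).1// setDE setCK setIC -setDE.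
Qed.

(** If a step backward from a point outside the interior of [M] ended in [M],
    the same step forward would return to the interior of [M]. *)
Lemma absorbing_setC_interior M h :
  closed M -> set_sub M (open_ray h) `<=` M° ->
  set_sub (~` M°) (open_ray (- h)) `<=` (~` M°)°.
Proof.
move=> Mcl MM; rewrite (interior_setC_interior _ _ Mcl MM).
apply/set_sub_rayP => x t NMx t0; rewrite scalerN opprK => Mxt; apply: NMx.
by move/set_sub_rayP: MM => /(_ _ _ Mxt t0); rewrite addrK.
Qed.

Lemma proper_setC_interior M h :
  proper_subset M -> set_sub M (open_ray h) `<=` M° ->
  proper_subset (~` M°).
Proof.
move=> [[x Mx] MT] /set_sub_rayP MM; split.
  apply/set0P/eqP; rewrite -setCT => /setC_inj MT'; apply: MT.
  by apply/seteqP; split=> // z _; apply: interior_subset; rewrite MT'.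
move=> NMT; have : (~` M°) (x - 1 *: h) by rewrite NMT.
by apply; exact: MM.
Qed.

End DirectionallyAbsorbing.

Theorem proposition10 (R : realType) (Y : topologicalLmodType R)
    (A : set Y) (k : Y)
    (A_closed : closed A) (A_proper : proper_subset A) (k_neq0 : k <> 0)
    (A_sub_ray : set_sub A (open_ray k) `<=` A°) :
  let A' : set Y := ~` A° in
  [/\ closed A', proper_subset A' & set_sub A' (open_ray (- k)) `<=` (A')°] /\
  [/\ (* (a) *)
      finite_valued (phi A k) = set_add (boundary A) (line k) /\
      finite_valued (phi A' (- k)) = set_add (boundary A) (line k),
      (* (b) *)
      nu_dom (phi A k) `&` nu_dom (phi A' (- k))
        = set_add (boundary A) (line k) &
      (* (c) *)
      forall y : Y, set_add (boundary A) (line k) y ->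
        phi A k y = nu_opp (phi A' (- k) y)].
Proof.
move=> A'.
have A'cl : closed A' by exact: closed_setC_interior.
have A'ray : set_sub A' (open_ray (- k)) `<=` (A')°.
  exact: absorbing_setC_interior.
have bdA' : boundary A' = boundary A.
  exact: boundary_setC_interior A_closed A_sub_ray.
have finA := finite_valued_phi _ _ _ _ A_closed A_sub_ray.
have finA' : finite_valued (phi A' (- k)) = set_add (boundary A) (line k).
  by rewrite -bdA' -lineN; exact: finite_valued_phi.
split; first by split=> //; exact: proper_setC_interior A_sub_ray.
split=> //.
- apply/seteqP; split=> [y [[yA|yA] [yA'|yA']]|y yb].
  + by rewrite -finA.
  + by rewrite -finA.
  + by rewrite -finA'.
  (* A finite or infinite infimum is taken over a nonempty set, so the walk
     meets [A'] somewhere, although it stays in the interior of [A]. *)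
  + have /phi_SomeP[[t A't] _] := yA'.
    by case: A't; rewrite scalerN -scaleNr; exact: phi_ninfty_interior yA _.
  + by split; left; [move: yb; rewrite -finA|move: yb; rewrite -finA'].
- move=> y /set_add_lineP[r yr].
  have -> : phi A k y = Some r%:E by apply/phi_finiteE.
  suff -> : phi A' (- k) y = Some (- r)%:E by rewrite /= opprK.
  by apply/phi_finiteE => //; rewrite bdA' scaleNr scalerN opprK.
Qed.
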